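(* Let $k\ge 3$ and let $N_k=\mathrm{span}\{I_k,E,E^2,\dots,E^{k-2},e_{12},e_{13},\dots,e_{1k}\}\subseteq UT_k(F)$, where $E=\sum_{i=1}^{k-1}e_{i,i+1}$ and $I_k$ is the identity matrix, regarded as a superalgebra with the trivial grading. Then $$C^{gr}(N_k)=\mathrm{Id}^{gr}(N_{k-1})=\langle [y_1,\dots,y_{k-1}],\ [y_1,y_2][y_3,y_4],\ z\rangle_{T_2}.$$
   Context: $F$ is a field of characteristic zero; $UT_k(F)$ is the algebra of upper triangular $k\times k$ matrices with matrix units $e_{ij}$. A superalgebra is an algebra $A=A_0\oplus A_1$ with $A_iA_j\subseteq A_{i+j\bmod 2}$ (trivial grading: $A_1=0$); $Z(A)$ is the center. $F\langle Y,Z\rangle$ is the free associative algebra on disjoint countable sets $Y=\{y_1,y_2,\dots\}$ (even variables) and $Z=\{z_1,z_2,\dots\}$ (odd variables); $z$ denotes an odd variable. $\mathrm{Id}^{gr}(A)$ is the set of graded identities of $A$ (polynomials vanishing under all substitutions of even variables by elements of $A_0$ and odd ones by elements of $A_1$); $C^{gr}(A)$ is the set of central graded polynomials (zero constant term and all such evaluations lie in $Z(A)$). $\langle S\rangle_{T_2}$ is the smallest ideal of $F\langle Y,Z\rangle$ containing $S$ and invariant under all grading-preserving endomorphisms. Commutators are left-normed: $[a,b]=ab-ba$, $[a_1,\dots,a_m]=[[a_1,\dots,a_{m-1}],a_m]$. *)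

(* Defs.v *)
From HB Require Import structures.
From mathcomp Require Import all_boot all_order all_algebra.
From mathcomp Require Import finmap.
From mathcomp.multinomials Require Import monalg.

Unset Printing Implicit Defensive.

Import Order.TTheory GRing.Theory Num.Theory.
Local Open Scope ring_scope.

(* Variables of the free algebra F<Y,Z>: inl i = y_i (even), inr i = z_i (odd). *)
Definition var := (nat + nat)%type.

(* The free associative algebra F<Y,Z>: finitely supported F-linear
   combinations of words (free monoid) over the variables. *)
Notation FA F := {malg F[{fmonom var}]}.

Definition yv (F : fieldType) (i : nat) : FA F := << fmu (inl i : var) >>.
Definition zv (F : fieldType) (i : nat) : FA F := << fmu (inr i : var) >>.

Definition commr {R : pzRingType} (a b : R) : R := a * b - b * a.
Definition lcomm {R : pzRingType} (a : R) (s : seq R) : R := foldl commr a s.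

Definition evalp {F : fieldType} {A : lalgType F} (phi : var -> A) (p : FA F) : A :=
  \sum_(m <- msupp p) p@_m *: \prod_(v <- (m : seq var)) phi v.

Definition eval_mx {F : fieldType} {k : nat} (phi : var -> 'M[F]_k) (p : FA F) : 'M[F]_k :=
  \sum_(m <- msupp p) p@_m *: \prod_(v <- (m : seq var)) phi v.

Definition zdeg (m : {fmonom var}) : nat := count (fun v : var => if v is inr _ then true else false) m.

Definition is_even_poly (F : fieldType) (p : FA F) : Prop :=
  forall m, m \in msupp p -> ~~ odd (zdeg m).
Definition is_odd_poly (F : fieldType) (p : FA F) : Prop :=
  forall m, m \in msupp p -> odd (zdeg m).

(* T2-ideals: two-sided ideals invariant under all grading-preserving
   endomorphisms of F<Y,Z> (which are exactly the substitutions sending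
   even variables to even polynomials and odd variables to odd ones). *)
Definition is_T2_ideal (F : fieldType) (I : FA F -> Prop) : Prop :=
  [/\ I 0,
      (forall p q, I p -> I q -> I (p + q)),
      (forall p q, I p -> I (q * p)),
      (forall p q, I p -> I (p * q)) &
      (forall (sigma : var -> FA F), (forall i, is_even_poly F (sigma (inl i))) ->
         (forall i, is_odd_poly F (sigma (inr i))) ->
         forall p, I p -> I (evalp sigma p))].

Definition T2_gen (F : fieldType) (S : FA F -> Prop) (f : FA F) : Prop :=
  forall I : FA F -> Prop, is_T2_ideal F I -> (forall s, S s -> I s) -> I f.

(* Matrices: 0-based matrix units e_{ij} in M_k(F). *)
Definition munit (F : fieldType) (k i j : nat) : 'M[F]_k :=
  \matrix_(r < k, c < k) (((r : nat) == i) && ((c : nat) == j))%:R.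

(* E = sum_{i=1}^{k-1} e_{i,i+1} (1-based), i.e. sum_{i<k-1} e_{i,i+1} 0-based *)
Definition Emx (F : fieldType) (k : nat) : 'M[F]_k :=
  \sum_(i < k.-1) munit F k i i.+1.

Definition Ngens (F : fieldType) (k : nat) : seq 'M[F]_k :=
  [seq (Emx F k) ^+ i | i <- iota 0 k.-1] ++ [seq munit F k 0 j | j <- iota 1 k.-1].

Definition span_of {F : fieldType} {k : nat} (s : seq 'M[F]_k) (A : 'M[F]_k) : Prop :=
  exists c : 'I_(size s) -> F, A = \sum_(i < size s) c i *: s`_i.

Definition Nk (F : fieldType) (k : nat) (A : 'M[F]_k) : Prop := span_of (Ngens F k) A.

Definition center_Nk (F : fieldType) (k : nat) (A : 'M[F]_k) : Prop :=
  Nk F k A /\ forall B, Nk F k B -> A * B = B * A.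

(* graded evaluations in N_k with trivial grading: even variables go to
   (N_k)_0 = N_k, odd variables go to (N_k)_1 = 0 *)
Definition graded_eval_Nk (F : fieldType) (k : nat) (phi : var -> 'M[F]_k) : Prop :=
  (forall i, Nk F k (phi (inl i))) /\ (forall i, phi (inr i) = 0).

Definition Id_gr_Nk (F : fieldType) (k : nat) (f : FA F) : Prop :=
  forall phi : var -> 'M[F]_k, graded_eval_Nk F k phi -> eval_mx phi f = 0.

Definition C_gr_Nk (F : fieldType) (k : nat) (f : FA F) : Prop :=
  f@_(mone : {fmonom var}) = 0 /\
  forall phi : var -> 'M[F]_k, graded_eval_Nk F k phi -> center_Nk F k (eval_mx phi f).

Definition thm_gens (F : fieldType) (k : nat) (f : FA F) : Prop :=
  f = lcomm (yv F 1) [seq yv F i | i <- iota 2 (k.-2)]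
  \/ f = commr (yv F 1) (yv F 2) * commr (yv F 3) (yv F 4)
  \/ f = zv F 1.

(* Main.v *)
Require Import Defs.
From HB Require Import structures.
From mathcomp Require Import all_boot all_order all_algebra.
From mathcomp Require Import finmap.
From mathcomp.multinomials Require Import monalg.
From mathcomp Require Import ring.
Import GRing.Theory.
Local Open Scope ring_scope.

Set Implicit Arguments.
Unset Strict Implicit.

(* Sorting a word [w] by insertion gives, in the free algebra itself,
     w = sort w + sum of terms g [x, j1, ..., jr],   j1 <= ... <= jr, j1 < x,
   where [g] is a word. Modulo [y1, y2] [y3, y4] the letters of [g] commute in
   front of the commutator, and modulo the long commutator the terms with
   r >= k - 2 vanish. The remaining terms are determined by the monomials
   a_g c_x b_j1 ... b_jr, and these are exactly the monomials in the top row of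
   the value of [w] at the matrices y_i |-> a_i + b_i (E - e_12) + c_i e_12.
   So a polynomial that vanishes at these matrices lies in the ideal: [F] is
   infinite, and the monomials are linearly independent as functions.
   Centrality in N_k gives the same equations as vanishing on N_(k-1), except
   that it only kills the coefficient of [t] in the diagonal part; at
   a_i (1 + t) this coefficient is the Euler derivative, and one divides by the
   degree. *)

(** * Polynomial functions over an infinite field *)

Lemma poly_eq0_of_horner (F : fieldType) (p : {poly F}) :
  [pchar F] =i pred0 -> (forall x, p.[x] = 0) -> p = 0.
Proof.
move=> /pcharf0P Fchar0 p0; apply/eqP/negP => /negP p_neq0.
have inj_nat : injective (fun i : nat => i%:R : F).
  have le_inj (i j : nat) : (i <= j)%N -> i%:R = j%:R :> F -> i = j.
    move=> le_ij eq_ij; apply/eqP; rewrite eqn_leq le_ij -subn_eq0 -Fchar0.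
    by rewrite natrB // eq_ij subrr eqxx.
  by move=> i j eq_ij; case/orP: (leq_total i j) => /le_inj-> //.
have := @max_poly_roots _ p [seq i%:R | i <- iota 0 (size p)] p_neq0.
rewrite map_inj_uniq // iota_uniq size_map size_iota ltnn => H.
by apply/notF/H => //; apply/allP => x _; apply/rootP/p0.
Qed.

(* Induction on a list of variables containing all those that occur: fixing the
   values of the other ones leaves a polynomial in the variable at hand, whose
   coefficients vanish because [F] is infinite. *)
Lemma sum_scale_of_monomials (F : fieldType) (M : lmodType F) (V : eqType)
    (T : Type) (r : seq T) (c : T -> F) (key : T -> seq V) (val : T -> M) :
  [pchar F] =i pred0 ->
  (forall s t, perm_eq (key s) (key t) -> val s = val t) ->
  (forall theta : V -> F, \sum_(t <- r) c t * \prod_(v <- key t) theta v = 0) ->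
  \sum_(t <- r) c t *: val t = 0.
Proof.
move=> Fchar0 val_key sum0.
(* The predicate [P] is carried along because the induction deletes [y] from the keys, after which
   equal keys force equal values only among terms of one degree in [y]. *)
suff gen (vs : seq V) (r' : seq T) (key' : T -> seq V) (P : pred T) :
    all P r' -> (forall t, P t -> {subset key' t <= vs}) ->
    (forall s t, P s -> P t -> perm_eq (key' s) (key' t) -> val s = val t) ->
    (forall theta : V -> F,
        \sum_(t <- r') c t * \prod_(v <- key' t) theta v = 0) ->
    \sum_(t <- r') c t *: val t = 0.
  apply: (gen (flatten (map key r)) r key
    (fun t => all (mem (flatten (map key r))) (key t))) => //.
  - elim: (r) => //= t s IH; apply/andP; split.
      by apply/allP => v kv; rewrite inE mem_cat kv.
    apply: sub_all IH => u /allP ku; apply/allP => v /ku /=.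
    by rewrite mem_cat => ->; rewrite orbT.
  - by move=> t /allP kt v /kt.
  - by move=> s t _ _; apply: val_key.
elim: vs => [|y vs IH] in r' key' P *.
  move=> Pr' key0 val0 sum0'.
  have key_nil t : P t -> key' t = [::].
    by move=> /key0; case: (key' t) => // v s /(_ v); rewrite mem_head => /(_ isT).
  case: r' Pr' sum0' => [|t0 r'] Pr' sum0'; first by rewrite big_nil.
  (* With no variable left, all keys are empty and all values agree with [val t0], so only the sum
     of the coefficients matters. *)
  have sumc : \sum_(t <- t0 :: r') c t = 0.
    apply: etrans (sum0' (fun=> 0)).
    elim: (t0 :: r') Pr' => [|t s IHs] /=; first by rewrite !big_nil.
    by case/andP=> Pt /IHs; rewrite !big_cons key_nil // big_nil mulr1 => ->.
  apply: etrans (etrans _ (scale0r (val t0))); last by rewrite -sumc.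
  rewrite scaler_suml.
  have Pt0 : P t0 by case/andP: Pr'.
  elim: (t0 :: r') Pr' => [|t s IHs] /=; first by rewrite !big_nil.
  case/andP=> Pt /IHs; rewrite !big_cons => ->.
  by rewrite (val0 t t0) // !key_nil.
move=> Pr' keyP val0 sum0'.
pose deg t := count_mem y (key' t).
pose rest t := [seq v <- key' t | v != y].
have slice n : \sum_(t <- r' | deg t == n) c t *: val t = 0.
  rewrite -big_filter.
  apply: (IH _ rest (fun t => P t && (deg t == n))).
  - by elim: r' Pr' {sum0'} => //= t s IHs /andP[Pt /IHs]; case: ifP => //= ->; rewrite Pt.
  - move=> t /andP[Pt _] v; rewrite mem_filter => /andP[vy /(keyP t Pt)].
    by rewrite inE (negPf vy).
  - move=> s t /andP[Ps /eqP ds] /andP[Pt /eqP dt] est; apply: val0 => //.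
    rewrite -(perm_filterC (pred1 y) (key' s)) perm_sym.
    rewrite -(perm_filterC (pred1 y) (key' t)).
    have aux k : [seq v <- k | v == y] = nseq (count_mem y k) y.
      by elim: k => //= v k ->; case: eqP => //= ->.
    rewrite [filter (pred1 y) _]aux [in X in perm_eq _ X]aux -/(deg s) -/(deg t) ds dt.
    by rewrite perm_cat2l perm_sym.
  move=> theta; rewrite big_filter.
  pose p := \sum_(t <- r') (c t * \prod_(v <- rest t) theta v) *: 'X^(deg t).
  have p0 : p = 0.
    apply: poly_eq0_of_horner => // x.
    pose theta' v := if v == y then x else theta v.
    apply: etrans (sum0' theta'); rewrite horner_sum; apply: eq_bigr => t _.
    rewrite hornerZ hornerXn -mulrA; congr (_ * _).
    rewrite [RHS](bigID (pred1 y)) /= mulrC; congr (_ * _).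
      rewrite (eq_bigr (fun=> x)); last by move=> v /eqP->; rewrite /theta' eqxx.
      by rewrite -big_filter big_const_seq count_predT size_filter iter_mulr_1.
    rewrite /rest big_filter; apply: eq_bigr => v vy.
    by rewrite /theta' (negPf vy).
  have := congr1 (fun q : {poly F} => q`_n) p0; rewrite coef0 coef_sum => p_n; apply: etrans p_n.
  rewrite big_mkcond /=; apply: eq_bigr => t _.
  by rewrite coefZ coefXn eq_sym; case: eqP; rewrite ?mulr1 ?mulr0.
pose N := (\sum_(t <- r') deg t).+1.
have : \sum_(n < N) \sum_(t <- r' | deg t == n) c t *: val t = 0.
  by apply: big1 => n _; apply: slice.
rewrite (exchange_big_dep predT) //= => sum_slices; apply: etrans sum_slices.
have : all (fun t => deg t < N)%N r'.
  rewrite {}/N; elim: (r') => //= t s IHs; rewrite big_cons ltnS leq_addr /=.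
  by apply: sub_all IHs => u /leq_trans; apply; rewrite ltnS leq_addl.
elim: (r') => [|t s IHs] /=; first by rewrite !big_nil.
case/andP=> ht hs; rewrite !big_cons (IHs hs); congr (_ + _).
by rewrite (big_pred1 (Ordinal ht)) // => n; rewrite eq_sym.
Qed.

(** The Leibniz rule, solved for the term in which [c] stands behind the commutator; it serves to
    absorb a factor between two commutators. *)
Lemma commr_mul_sub (A : pzRingType) (a b c : A) :
  commr a b * c = commr a (b * c) - b * commr a c.
Proof. by rewrite /commr !mulrBr !mulrBl !mulrA opprB addrA subrK. Qed.

(** * Insertion sort of words in a ring, with commutator corrections *)

Section InsertionSort.
Variables (A : pzRingType) (X : nat -> A).

Definition wprod (s : seq nat) : A := \prod_(i <- s) X i.

(** The value 0 for [x <= j] records that [x] need not pass a letter that is not smaller; so the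
    correction sums can run over all splittings, whatever [x] is. *)
Definition lcomm_lt (x : nat) (s : seq nat) : A :=
  if s is j :: _ then if (j < x)%N then lcomm (X x) [seq X i | i <- s] else 0
  else 0.

(* [s] is decreasing. A pair [(g, t)] splits the letters of [s] into those moved
   to the left of the commutator and the (nonempty) rest, entering it. *)
Fixpoint splits (s : seq nat) : seq (seq nat * seq nat) :=
  if s is j :: s' then
    (rev s', [:: j]) :: [seq (rcons gt.1 j, gt.2) | gt <- splits s']
      ++ [seq (gt.1, rcons gt.2 j) | gt <- splits s']
  else [::].

(* A triple [(g, x, t)] stands for [wprod g * lcomm_lt x t]. *)
Fixpoint corrections (w : seq nat) : seq (seq nat * nat * seq nat) :=
  if w is x :: w' then
    [seq (x :: k.1.1, k.1.2, k.2) | k <- corrections w']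
      ++ [seq (gt.1, x, gt.2) | gt <- splits (rev (sort leq w'))]
  else [::].

Lemma lcomm_rcons (a : A) s b : lcomm a (rcons s b) = commr (lcomm a s) b.
Proof. by rewrite /lcomm foldl_rcons. Qed.

Lemma wprod_rcons s j : wprod (rcons s j) = wprod s * X j.
Proof. by rewrite /wprod -cats1 big_cat big_seq1. Qed.

Lemma splits_neq0 s gt : gt \in splits s -> gt.2 != [::].
Proof.
elim: s gt => //= j s IH gt; rewrite inE mem_cat.
case/or3P => [/eqP -> //|/mapP[u /IH ut ->]//|/mapP[u /IH ut ->]] /=.
by case: (u.2).
Qed.

Lemma lcomm_lt_rcons x t j : t != [::] ->
  lcomm_lt x (rcons t j) = commr (lcomm_lt x t) (X j).
Proof.
case: t => //= i t _; case: ifP => _; first by rewrite map_rcons -lcomm_rcons.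
by rewrite /commr mul0r mulr0 subrr.
Qed.

Lemma sort_rcons_max (u : seq nat) j :
  all (geq j) u -> sort leq (rcons u j) = rcons (sort leq u) j.
Proof.
move=> uj; apply: (sorted_eq leq_trans anti_leq).
- exact: sort_sorted leq_total _.
- rewrite -[rcons _ _]revK rev_rcons rev_sorted /= path_sortedE; last first.
    by move=> a b c ba ac; apply: leq_trans ac ba.
  by rewrite all_rev all_sort uj rev_sorted sort_sorted //; apply: leq_total.
- by rewrite perm_sort perm_rcons perm_sym perm_rcons perm_cons perm_sort.
Qed.

Lemma sort_cons_max x (u : seq nat) :
  all (geq x) u -> sort leq (x :: u) = rcons (sort leq u) x.
Proof.
move=> ux; rewrite -sort_rcons_max //; apply/perm_sortP => //.
- exact: leq_total. - exact: leq_trans. - exact: anti_leq.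
by rewrite perm_sym perm_rcons.
Qed.

(** Induction on the last letter [j] of the sorted word. A term g [x, t] j equals g j [x, t] + g
    [x, t, j], which gives the two mapped families in [splits]; carrying [x] past [j] costs one new
    term with t = [j], nonzero only if j < x. *)
Lemma mul_wprod_sorted x s : sorted geq s ->
  X x * wprod (rev s) = wprod (sort leq (x :: rev s))
    + \sum_(gt <- splits s) wprod gt.1 * lcomm_lt x gt.2.
Proof.
elim: s => [|j s IH] js; first by rewrite big_nil addr0 /wprod !big_seq1 big_nil mulr1.
have {}IH := IH (path_sorted js).
have sorted_rev u : sorted geq u -> sort leq (rev u) = rev u.
  by move=> gu; apply: sorted_sort leq_trans _ _; rewrite rev_sorted.
have sj : all (geq j) s.
  move: js; rewrite /= path_sortedE; first by case/andP.
  by move=> a b c ba ac; apply: leq_trans ac ba.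
rewrite [in LHS]rev_cons wprod_rcons mulrA IH mulrDl.
rewrite big_cons big_cat /= !big_map /=.
have -> : \sum_(gt <- splits s) wprod (rcons gt.1 j) * lcomm_lt x gt.2
    + \sum_(gt <- splits s) wprod gt.1 * lcomm_lt x (rcons gt.2 j)
    = (\sum_(gt <- splits s) wprod gt.1 * lcomm_lt x gt.2) * X j.
  rewrite mulr_suml -big_split; apply: eq_big_seq => gt /splits_neq0 t0 /=.
  by rewrite lcomm_lt_rcons // wprod_rcons /commr mulrBr !mulrA addrC subrK.
rewrite addrA; congr (_ + _); case: ltnP => [jx|xj].
  have sx : all (geq x) s by apply: sub_all sj => i /leq_trans; apply; apply: ltnW.
  rewrite !sort_cons_max ?all_rev //=; last by rewrite (ltnW jx).
  rewrite !sorted_rev ?(path_sorted js) // rev_cons !wprod_rcons.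
  by rewrite /lcomm /= /commr mulrBr !mulrA addrC subrK.
by rewrite mulr0 addr0 rev_cons -rcons_cons sort_rcons_max ?wprod_rcons //= xj all_rev.
Qed.

Lemma wprod_insertion_sort w :
  wprod w = wprod (sort leq w)
    + \sum_(k <- corrections w) wprod k.1.1 * lcomm_lt k.1.2 k.2.
Proof.
elim: w => [|x w IH] /=; first by rewrite big_nil addr0.
rewrite big_cat !big_map /= [LHS]big_cons -/(wprod w) {1}IH mulrDr.
have := @mul_wprod_sorted x (rev (sort leq w)).
rewrite revK rev_sorted => -> //; last exact: sort_sorted leq_total _.
rewrite -addrA [X in _ + X]addrC; congr (_ + _).
  congr wprod; apply/perm_sortP; last by rewrite perm_cons perm_sort.
  - exact: leq_total.
  - exact: leq_trans.
  - exact: anti_leq.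
rewrite mulr_sumr; congr (_ + _); apply: eq_bigr => k _.
by rewrite /wprod big_cons mulrA.
Qed.

End InsertionSort.

(** * Coefficients in products of generic matrices *)

Section GenericEvaluation.
Variables (F : fieldType) (a b c : nat -> F).

Definition linear_eval (s : seq nat) : {poly F} :=
  \prod_(i <- s) ((a i)%:P + b i *: 'X).

(** The top row of a product of generic matrices: the first letter contributes either its diagonal
    entry [a x], and the row comes from the later letters, or its entry [c x], followed by the
    Toeplitz blocks of all later letters. *)
Fixpoint corner_eval (w : seq nat) : {poly F} :=
  if w is x :: w' then a x *: corner_eval w' + c x *: linear_eval w' else 0.

Lemma coef_linear_eval s n : (linear_eval s)`_n.+1 =
  \sum_(gt <- splits s | size gt.2 == n.+1)
    (\prod_(i <- gt.1) a i * \prod_(i <- gt.2) b i).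
Proof.
(* The constant term is the choice of [a i] in every factor, the one splitting that [splits] leaves
   out. *)
have gen : linear_eval s = (\prod_(i <- s) a i)%:P + \sum_(gt <- splits s)
    (\prod_(i <- gt.1) a i * \prod_(i <- gt.2) b i) *: 'X^(size gt.2).
  elim: s => [|j s IH]; first by rewrite /linear_eval !big_nil addr0.
  rewrite /linear_eval /= !big_cons -/(linear_eval s) IH big_cat !big_map /=.
  rewrite mulrDr !mulrDl -!addrA; congr (_ + _).
    by rewrite polyCM.
  congr (_ + _).
    rewrite [in RHS](perm_big s) ?perm_rev //= big_nil mulr1 -!mul_polyC polyCM; ring.
  rewrite !mulr_sumr; congr (_ + _); apply: eq_bigr => gt _.
    by rewrite -cats1 big_cat big_seq1 /= -!mul_polyC !polyCM; ring.
  rewrite size_rcons -cats1 big_cat big_seq1 /= -!mul_polyC !polyCM exprS; ring.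
rewrite gen coefD coefC add0r coef_sum [RHS]big_mkcond /=; apply: eq_bigr => gt _.
by rewrite coefZ coefXn eq_sym; case: eqP; rewrite ?mulr1 ?mulr0.
Qed.

(** [corner_eval] and [corrections] obey the same recursion: the first letter either stays in front,
    with factor [a x], or opens the commutator, with factor [c x]. Sorting the rest is harmless
    because [linear_eval] is symmetric. Corrections with [lcomm_lt] equal to 0 are counted as
    well. *)
Lemma coef_corner_eval w n : (corner_eval w)`_n.+1 =
  \sum_(k <- corrections w | size k.2 == n.+1)
    (\prod_(i <- k.1.1) a i * c k.1.2 * \prod_(i <- k.2) b i).
Proof.
elim: w => [|x w IH] /=; first by rewrite big_nil coef0.
rewrite coefD !coefZ IH big_cat !big_map /= !mulr_sumr; congr (_ + _).
  by apply: eq_bigr => k _; rewrite big_cons !mulrA.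
have -> : linear_eval w = linear_eval (rev (sort leq w)).
  by apply: perm_big; rewrite perm_sym perm_rev perm_sort.
rewrite coef_linear_eval mulr_sumr; apply: eq_bigr => gt _.
by rewrite mulrA (mulrC (c x)).
Qed.

End GenericEvaluation.

(** The commutative monomial of a correction, in three disjoint families of variables: [inl (inl i)]
    for a_i, [inl (inr i)] for b_i and [inr i] for c_i. *)
Definition encode (k : seq nat * nat * seq nat) : seq (nat + nat + nat) :=
  map (inl \o inl) k.1.1 ++ inr k.1.2 :: map (inl \o inr) k.2.

Lemma perm_encode k l : perm_eq (encode k) (encode l) ->
  [/\ perm_eq k.1.1 l.1.1, k.1.2 = l.1.2 & perm_eq k.2 l.2].
Proof.
pose getl (v : nat + nat + nat) := if v is inl (inl i) then Some i else None.
pose getr (v : nat + nat + nat) := if v is inl (inr i) then Some i else None.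
pose getc (v : nat + nat + nat) := if v is inr i then Some i else None.
have pmap_some (f : nat + nat + nat -> option nat) (u : nat -> nat + nat + nat) s :
    (forall i, f (u i) = Some i) -> pmap f [seq u i | i <- s] = s.
  by move=> fu; elim: s => //= i s ->; rewrite fu.
have pmap_none (f : nat + nat + nat -> option nat) (u : nat -> nat + nat + nat) s :
    (forall i, f (u i) = None) -> pmap f [seq u i | i <- s] = [::].
  by move=> fu; elim: s => //= i s ->; rewrite fu.
move=> kl; split.
- move/(perm_pmap getl): kl; rewrite !pmap_cat /=.
  by rewrite !(pmap_some getl (inl \o inl)) // !(pmap_none getl (inl \o inr)) // !cats0.
- move/(perm_pmap getc): kl; rewrite !pmap_cat /=.
  rewrite !(pmap_none getc (inl \o inl)) // !(pmap_none getc (inl \o inr)) //=.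
  by move/perm_mem/(_ k.1.2); rewrite !inE eqxx => /esym/eqP.
- move/(perm_pmap getr): kl; rewrite !pmap_cat /=.
  by rewrite !(pmap_none getr (inl \o inl)) // !(pmap_some getr (inl \o inr)).
Qed.

Lemma splits_subseq s gt : gt \in splits s -> subseq gt.2 (rev s).
Proof.
elim: s gt => //= j s IH gt; rewrite inE mem_cat rev_cons.
case/or3P => [/eqP->|/mapP[u us ->]|/mapP[u us ->]] /=.
- by rewrite sub1seq mem_rcons mem_head.
- exact: subseq_trans (IH u us) (subseq_rcons _ _).
- by rewrite -!cats1 cat_subseq ?IH.
Qed.

(** The letters inside a commutator form a subsequence of a sorted word, so only the word in front
    still has to be sorted. *)
Lemma corrections_sorted w k : k \in corrections w -> sorted leq k.2 && (k.2 != [::]).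
Proof.
elim: w k => //= x w IH k; rewrite mem_cat.
case/orP => /mapP[u us ->] /=; first exact: IH.
rewrite (splits_neq0 us) andbT; apply: subseq_sorted leq_trans _ _ (splits_subseq us) _.
by rewrite revK sort_sorted //; apply: leq_total.
Qed.

(** * A criterion for membership in an ideal containing the two kinds of commutator expressions *)

Section IdealMembership.
Variables (F : fieldType) (A : lalgType F) (X : nat -> A) (I : A -> Prop) (n : nat).
Hypothesis Fchar0 : [pchar F] =i pred0.
Hypotheses (I0 : I 0) (ID : forall p q, I p -> I q -> I (p + q))
  (IZ : forall c p, I p -> I (c *: p)) (IM : forall p q, I p -> I (q * p)).
Hypothesis Icomm : forall i s v x t, t != [::] ->
  I (commr (X i) (wprod X s) * wprod X v * lcomm (X x) [seq X j | j <- t]).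
Hypothesis Ilong : forall x t, (n <= size t)%N ->
  I (lcomm (X x) [seq X j | j <- t]).

Lemma ideal_sum (T : eqType) (r : seq T) (f : T -> A) :
  (forall t, t \in r -> I (f t)) -> I (\sum_(t <- r) f t).
Proof. by move=> If; rewrite big_seq; apply: big_ind. Qed.

Lemma lcomm_lt_swap i s v x t :
  I (commr (X i) (wprod X s) * wprod X v * lcomm_lt X x t).
Proof.
case: t => [|j t] /=; first by rewrite mulr0.
by case: ifP => _; [apply: (@Icomm i s v x (j :: t)) | rewrite mulr0].
Qed.

(** Bringing the letter [i] to the front of [h] costs a commutator of [X i] with the letters before
    it, and in front of [lcomm_lt] that term lies in [I]. *)
Lemma wprod_perm_ideal g h x t : perm_eq g h ->
  I (wprod X g * lcomm_lt X x t - wprod X h * lcomm_lt X x t).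
Proof.
elim: g h => [|i g IH] h; first by rewrite perm_sym => /perm_nilP->; rewrite subrr.
move=> gh; have /splitPr hi : i \in h by rewrite -(perm_mem gh) mem_head.
case: hi gh => u v gh.
have {}gh : perm_eq g (u ++ v).
  by rewrite -(perm_cons i) (perm_trans gh) // -[i :: v]cat1s perm_catCA.
have := ID (@IM _ (X i) (IH _ gh)) (lcomm_lt_swap i u v x t).
congr I; rewrite /wprod !(big_cat, big_cons) /= /commr.
by rewrite mulrBr !mulrBl !mulrA addrA subrK.
Qed.

(** A representative modulo [I] that depends only on the monomial [encode k], so that linear
    independence of monomials applies to it. *)
Definition sorted_correction (k : seq nat * nat * seq nat) : A :=
  wprod X (sort leq k.1.1) * lcomm_lt X k.1.2 (sort leq k.2).

Lemma sorted_correction_perm k l :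
  perm_eq (encode k) (encode l) -> sorted_correction k = sorted_correction l.
Proof.
have sortP := perm_sortP leq_total leq_trans anti_leq.
by case/perm_encode => /sortP k1 k2 /sortP k3; rewrite /sorted_correction k1 k2 k3.
Qed.

Lemma sorted_correction_ideal w k : k \in corrections w ->
  I (wprod X k.1.1 * lcomm_lt X k.1.2 k.2 - sorted_correction k).
Proof.
case/corrections_sorted/andP => k2 _; rewrite /sorted_correction.
rewrite (sorted_sort leq_trans k2); apply: wprod_perm_ideal.
by rewrite perm_sym perm_sort.
Qed.

Lemma mem_ideal_of_evaluations (T : eqType) (r : seq T) (c : T -> F) (w : T -> seq nat) :
  (forall a : nat -> F, \sum_(t <- r) c t * \prod_(i <- w t) a i = 0) ->
  (forall (a b u : nat -> F) l, (l.+1 < n)%N ->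
     \sum_(t <- r) c t * (corner_eval a b u (w t))`_l.+1 = 0) ->
  I (\sum_(t <- r) c t *: wprod X (w t)).
Proof.
move=> commutative0 corner0.
under eq_bigr => t _ do rewrite (wprod_insertion_sort X) scalerDr.
(* The sorted words cancel exactly, not only modulo [I], since [sort leq (w t)] depends only on the
   multiset of letters of [w t]. *)
rewrite big_split /= (@sum_scale_of_monomials F A _ _ r c w) //; first last.
  by move=> s t /(perm_sortP leq_total leq_trans anti_leq) ->.
rewrite add0r.
pose S := \sum_(t <- r) c t *: \sum_(k <- corrections (w t)) sorted_correction k.
rewrite -[X in I X](subrK S); apply: ID.
  rewrite -sumrB; apply: ideal_sum => t _.
  rewrite -scalerBr -sumrB; apply: IZ; apply: ideal_sum => k; exact: sorted_correction_ideal.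
pose deg_part l := \sum_(t <- r) c t *:
  \sum_(k <- corrections (w t) | size k.2 == l) sorted_correction k.
have deg_part_ideal l : I (deg_part l).
  case: l => [|l].
    rewrite /deg_part; apply: ideal_sum => t _; apply: IZ.
    rewrite big_seq_cond big1 // => k /andP[/corrections_sorted/andP[_]].
    by rewrite -size_eq0 => /negPf->.
  have [ln|nl] := ltnP l.+1 n; last first.
    rewrite /deg_part; apply: ideal_sum => t _; apply: IZ; rewrite -big_filter.
    apply: ideal_sum => k; rewrite mem_filter => /andP[/eqP kl _]; apply: IM.
    rewrite /lcomm_lt; case Es: (sort leq k.2) => [//|j s]; case: ifP => // _.
    by rewrite -Es; apply: Ilong; rewrite size_sort kl.
  pose terms := [seq (c t, k) | t <- r,
    k <- [seq k <- corrections (w t) | size k.2 == l.+1]].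
  have -> : deg_part l.+1 = \sum_(p <- terms) p.1 *: sorted_correction p.2.
    rewrite big_allpairs_dep /=; apply: eq_bigr => t _.
    by rewrite big_filter scaler_sumr.
  rewrite (@sum_scale_of_monomials F A _ _ _ _ (fun p => encode p.2)) //.
    by move=> s t; apply: sorted_correction_perm.
  move=> theta; rewrite big_allpairs_dep /=.
  (* A point [theta] of the encoded variables is a triple of points, one for each family. *)
  rewrite -[RHS](corner0 (theta \o inl \o inl) (theta \o inl \o inr) (theta \o inr) l ln).
  apply: eq_bigr => t _; rewrite coef_corner_eval big_filter mulr_sumr.
  by apply: eq_bigr => k _; rewrite /encode big_cat big_cons !big_map /= !mulrA.
(* [N] exceeds the size of every commutator part, so the degree parts below [N] exhaust [S]. *)
pose N := (\sum_(t <- r) \sum_(k <- corrections (w t)) size k.2).+1.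
suff -> : S = \sum_(l <- iota 0 N) deg_part l by apply: ideal_sum => l _.
rewrite /deg_part exchange_big /= /S; apply: eq_big_seq => t rt.
rewrite -scaler_sumr; congr (_ *: _).
rewrite (exchange_big_dep predT) //=; apply: eq_big_seq => k kw.
have kN : size k.2 \in iota 0 N.
  by rewrite mem_iota add0n ltnS (big_rem t) //= (big_rem k) //= -addnA leq_addr.
rewrite big_mkcond (bigD1_seq (size k.2) kN (iota_uniq 0 N)).
by rewrite eqxx big1 /= ?addr0 // => l; rewrite eq_sym => /negPf->.
Qed.

End IdealMembership.

(** * The algebra N_k as pairs of truncated polynomials *)

Section BorderedToeplitz.
Variables (F : fieldType) (n : nat).

(* The elements of [Nk F n.+1] are the matrices [[p_0, u], [0, p(E)]]: below the
   first row an upper triangular Toeplitz block, right of the corner the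
   coefficients of [u]. Both polynomials only matter modulo [X^n]. *)
Definition btoep (p u : {poly F}) : 'M[F]_n.+1 :=
  \matrix_(i, j) match (i : nat), (j : nat) with
    | 0, 0 => p`_0
    | 0, j'.+1 => u`_j'
    | _.+1, 0 => 0
    | i'.+1, j'.+1 => ('X^i' * p)`_j'
    end.

Lemma coef_mul_trunc (p q : {poly F}) (j : nat) : (j < n)%N ->
  \sum_(l < n) p`_l * ('X^l * q)`_j = (p * q)`_j.
Proof.
move=> jn; rewrite coefM (big_ord_widen n (fun l => p`_l * q`_(j - l))) //.
rewrite [RHS]big_mkcond; apply: eq_bigr => l _.
by rewrite coefXnM ltnS; case: (ltnP j l); rewrite ?mulr0.
Qed.

Lemma btoepM p u q v :
  btoep p u * btoep q v = btoep (p * q) (p`_0 *: v + u * q).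
Proof.
apply/matrixP => i j; rewrite !mxE big_ord_recl !mxE /=.
under eq_bigr => l _ do rewrite !mxE /=.
case: i j => [[|i] hi] [[|j] hj] /=.
- by rewrite big1 ?addr0 ?coef0M // => l _; rewrite mulr0.
- by rewrite coefD coefZ coef_mul_trunc.
- by rewrite mul0r big1 ?addr0 // => l _; rewrite mulr0.
- by rewrite mul0r add0r coef_mul_trunc // mulrA.
Qed.

Lemma btoepD p u q v : btoep p u + btoep q v = btoep (p + q) (u + v).
Proof.
by apply/matrixP => [[[|i] hi] [[|j] hj]]; rewrite !mxE /= ?coefD ?addr0 // mulrDr coefD.
Qed.

Lemma btoepZ a p u : a *: btoep p u = btoep (a *: p) (a *: u).
Proof.
by apply/matrixP => [[[|i] hi] [[|j] hj]]; rewrite !mxE /= ?coefZ ?mulr0 // -scalerAr coefZ.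
Qed.

Lemma btoep_sum T (r : seq T) (p u : T -> {poly F}) :
  \sum_(t <- r) btoep (p t) (u t) = btoep (\sum_(t <- r) p t) (\sum_(t <- r) u t).
Proof.
elim: r => [|t r IH]; last by rewrite !big_cons IH btoepD.
by rewrite !big_nil; apply/matrixP => [[[|i] hi] [[|j] hj]]; rewrite !mxE /= ?mulr0 ?coef0.
Qed.

Lemma btoep0 : btoep 0 0 = 0.
Proof. by have := @btoep_sum unit [::] (fun=> 0) (fun=> 0); rewrite !big_nil. Qed.

Lemma btoep1 : btoep 1 0 = 1.
Proof.
apply/matrixP => [[[|i] hi] [[|j] hj]]; rewrite !mxE /= ?coef1 ?coef0 //.
by rewrite mulr1 coefXn eq_sym.
Qed.

Lemma btoep_eq (p u q v : {poly F}) : p`_0 = q`_0 ->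
  (forall j, (j < n)%N -> p`_j = q`_j) -> (forall j, (j < n)%N -> u`_j = v`_j) ->
  btoep p u = btoep q v.
Proof.
move=> pq0 pq uv; apply/matrixP => [[[|i] hi] [[|j] hj]]; rewrite !mxE //=.
  exact: uv.
by rewrite !coefXnM; case: ifP => // _; rewrite pq // (leq_ltn_trans (leq_subr _ _)).
Qed.

Lemma btoep_inj p u q v : btoep p u = btoep q v ->
  [/\ p`_0 = q`_0, forall j, (j < n)%N -> p`_j = q`_j & forall j, (j < n)%N -> u`_j = v`_j].
Proof.
move/matrixP => pq; split=> [|j jn|j jn].
- by have := pq ord0 ord0; rewrite !mxE.
- have n0 : (0 < n)%N by apply: leq_ltn_trans jn.
  (* Row 1 is the first row of the Toeplitz block and lists the coefficients of [p] unshifted. *)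
  have := pq (@Ordinal n.+1 1 n0) (@Ordinal n.+1 j.+1 jn).
  by rewrite !mxE /= expr0 !mul1r.
- by have := pq ord0 (@Ordinal n.+1 j.+1 jn); rewrite !mxE.
Qed.

(** The blocks are polynomials in one matrix and commute, so only the top row survives. Hence
    products of two commutators vanish, and each further bracket multiplies the row by a polynomial
    without constant term. *)
Lemma btoep_commr p u q v : commr (btoep p u) (btoep q v) =
  btoep 0 (u * (q - (q`_0)%:P) - v * (p - (p`_0)%:P)).
Proof.
rewrite /commr !btoepM -scaleN1r btoepZ btoepD !scaleN1r; congr (btoep _ _).
  by rewrite mulrC subrr.
by rewrite -!mul_polyC; ring.
Qed.

Lemma Emx_btoep : Emx F n.+1 = btoep 'X 1.
Proof.
apply/matrixP => i j; rewrite /Emx summxE.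
transitivity ((j == i.+1 :> nat)%:R : F).
  under eq_bigr => l _ do rewrite mxE /=.
  have [ij|ij] := eqVneq (j : nat) i.+1; last first.
    rewrite big1 // => l _; case: eqP => //= il; case: eqP => // jl.
    by case/eqP: ij; rewrite jl il.
  have hin : (i < n)%N by rewrite -ltnS -ij.
  rewrite (bigD1 (Ordinal hin)) //= eqxx ij eqxx big1 ?addr0 // => l li.
  case: eqP => // il; case/eqP: li; exact: val_inj.
rewrite mxE; case: i j => [[|i] hi] [[|j] hj] //=; rewrite ?coefX ?coef1 //.
by rewrite -exprSr coefXn eqSS.
Qed.

Lemma munit_btoep j : munit F n.+1 0 j.+1 = btoep 0 ('X^j).
Proof.
apply/matrixP => [[[|i] hi] [[|l] hl]]; rewrite !mxE /= ?coefXn ?mulr0 ?coef0 //.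
Qed.

Lemma EmxX_btoep i : Emx F n.+1 ^+ i.+1 = btoep ('X^(i.+1)) ('X^i).
Proof.
elim: i => [|i IH]; first by rewrite expr1 Emx_btoep.
by rewrite exprS IH Emx_btoep btoepM coefX scale0r add0r mul1r -exprS.
Qed.

Lemma span_of_lincomb (s : seq 'M[F]_n.+1) (T : eqType) (r : seq T) (c : T -> F) f :
  (forall t, t \in r -> span_of s (f t)) -> span_of s (\sum_(t <- r) c t *: f t).
Proof.
elim: r => [|t r IH] sf.
  by exists (fun=> 0); rewrite big_nil big1 // => i _; rewrite scale0r.
have [d fd] : span_of s (\sum_(u <- r) c u *: f u).
  by apply: IH => u ur; apply: sf; rewrite inE ur orbT.
have [e fe] := sf t (mem_head _ _).
exists (fun i => c t * e i + d i); rewrite big_cons fd fe scaler_sumr -big_split.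
by apply: eq_bigr => i _ /=; rewrite scalerDl scalerA.
Qed.

Lemma span_of_mem (s : seq 'M[F]_n.+1) A : A \in s -> span_of s A.
Proof.
move=> As; exists (fun i => (i == index A s :> nat)%:R).
rewrite -index_mem in As; rewrite (bigD1 (Ordinal As)) //= eqxx scale1r nth_index -?index_mem //.
rewrite big1 ?addr0 // => i; rewrite -val_eqE => /negPf /= ->; exact: scale0r.
Qed.

(** The generators stop at the power n - 1 of E, which suffices because [p] matters only modulo X^n;
    the matrix units make the top row arbitrary. *)
Lemma NkP A : (0 < n)%N -> Nk F n.+1 A <-> exists p u, A = btoep p u.
Proof.
move=> n0; split=> [[c ->]|[p [u ->]]].
  apply: (big_ind (fun A => exists p u, A = btoep p u)).
  - by exists 0, 0; rewrite btoep0.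
  - by move=> _ _ [p [u ->]] [q [v ->]]; exists (p + q), (u + v); rewrite btoepD.
  - move=> i _; have : (Ngens F n.+1)`_i \in Ngens F n.+1 by apply: mem_nth.
    rewrite mem_cat => /orP[/mapP[[|j] _ ->]|/mapP[[|j]]].
    + by exists (c i *: 1), (c i *: 0); rewrite -btoepZ btoep1.
    + by exists (c i *: 'X^(j.+1)), (c i *: 'X^j); rewrite -btoepZ EmxX_btoep.
    + by rewrite mem_iota.
    + by move=> _ ->; exists (c i *: 0), (c i *: 'X^j); rewrite -btoepZ munit_btoep.
have trunc (q : {poly F}) j : (j < n)%N -> (\sum_(i <- index_iota 0 n) q`_i *: 'X^i)`_j = q`_j.
  move=> jn; rewrite coef_sum big_mkord.
  rewrite (bigD1 (Ordinal jn)) //= coefZ coefXn eqxx mulr1 big1 ?addr0 // => i.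
  by rewrite -val_eqE coefZ coefXn eq_sym => /negPf /= ->; rewrite mulr0.
have spanD B C : Nk F n.+1 B -> Nk F n.+1 C -> Nk F n.+1 (B + C).
  move=> sB sC.
  have := @span_of_lincomb _ _ [:: true; false] (fun=> 1) (fun b => if b then B else C).
  by rewrite big_cons big_seq1 !scale1r; apply=> [[]].
have unit_span j : (j < n)%N -> Nk F n.+1 (btoep 0 ('X^j)).
  move=> jn; rewrite -munit_btoep; apply: span_of_mem; rewrite mem_cat orbC map_f //.
  by rewrite mem_iota /= add1n ltnS.
have power_span i : (i < n)%N -> Nk F n.+1 (Emx F n.+1 ^+ i).
  move=> jn; apply: span_of_mem; rewrite mem_cat (map_f (fun j => _ ^+ j)) //.
  by rewrite mem_iota.
have -> : btoep p u = \sum_(i <- index_iota 0 n) p`_i *: btoep ('X^i) 0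
    + \sum_(j <- index_iota 0 n) u`_j *: btoep 0 ('X^j).
  under eq_bigr do rewrite btoepZ; under [X in _ + X]eq_bigr do rewrite btoepZ.
  rewrite !btoep_sum btoepD; apply: btoep_eq => [|j jn|j jn];
    rewrite coefD -?scaler_suml !trunc ?scaler0 ?coef0 ?addr0 ?add0r //.
apply: (spanD _ _); apply: span_of_lincomb => i; rewrite mem_index_iota /= => ltin;
  last exact: unit_span.
case: i ltin => [|i] ltin.
  by rewrite expr0 btoep1 -(expr0 (Emx F n.+1)); apply: (power_span _).
(* A power of E also has an entry in the top row, which a matrix unit removes. *)
have -> : btoep ('X^(i.+1)) 0 = Emx F n.+1 ^+ i.+1 + btoep 0 (- 'X^i).
  by rewrite EmxX_btoep btoepD addr0 subrr.
apply: (spanD _ _); first exact: (power_span _).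
have -> : btoep 0 (- 'X^i) = \sum_(j <- [:: i]) (-1) *: btoep 0 ('X^j).
  by rewrite big_seq1 btoepZ scaler0 scaleN1r.
by apply: span_of_lincomb => j; rewrite inE => /eqP->; apply/unit_span/ltnW.
Qed.

End BorderedToeplitz.

(** * Evaluation as an algebra homomorphism *)

Section Evaluation.
Variables (F : fieldType) (A : lalgType F) (phi : var -> A).
Hypothesis scaleAr : forall c (x y : A), c *: (x * y) = x * (c *: y).

Definition word_eval (m : {fmonom var}) : A := \prod_(v <- (m : seq var)) phi v.

Lemma word_eval_mmorphism : mmorphism word_eval.
Proof. by split=> [m1 m2|]; rewrite /word_eval ?fmM ?big_cat // fm1 big_nil. Qed.

HB.instance Definition _ :=
  monalg.isMultiplicative.Build {fmonom var} A word_eval word_eval_mmorphism.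

Lemma evalpE p : evalp phi p = mmap (in_alg A) word_eval p.
Proof. by rewrite mmapE; apply: eq_bigr => m _; rewrite mulr_algl. Qed.

Lemma evalpM p q : evalp phi (p * q) = evalp phi p * evalp phi q.
Proof.
have comm (g : FA F) m m' : GRing.comm (in_alg A g@_m) (word_eval m').
  by rewrite /GRing.comm /= mulr_algl -scaleAr mulr1.
by rewrite !evalpE; case: (commr_mmap_is_multiplicative comm) => ->.
Qed.

Lemma evalp0 : evalp phi 0 = 0.
Proof. by rewrite evalpE raddf0. Qed.

Lemma evalpD p q : evalp phi (p + q) = evalp phi p + evalp phi q.
Proof. by rewrite !evalpE raddfD. Qed.

Lemma evalpB p q : evalp phi (p - q) = evalp phi p - evalp phi q.
Proof. by rewrite !evalpE raddfB. Qed.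

Lemma evalp_sum T (r : seq T) (f : T -> FA F) :
  evalp phi (\sum_(t <- r) f t) = \sum_(t <- r) evalp phi (f t).
Proof. by elim: r => [|t r IH]; rewrite ?big_nil ?evalp0 // !big_cons evalpD IH. Qed.

Lemma evalpZ c p : evalp phi (c *: p) = c *: evalp phi p.
Proof. by rewrite !evalpE mmapZ /= mulr_algl. Qed.

Lemma evalpU m : evalp phi << m >> = word_eval m.
Proof. by rewrite evalpE mmapU /= scale1r mul1r. Qed.

Lemma evalp_var v : evalp phi << fmu v >> = phi v.
Proof. by rewrite evalpU /word_eval fmU big_seq1. Qed.

Lemma evalp_prod T (r : seq T) (f : T -> FA F) :
  evalp phi (\prod_(t <- r) f t) = \prod_(t <- r) evalp phi (f t).
Proof.
elim: r => [|t r IH]; last by rewrite !big_cons evalpM IH.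
by rewrite !big_nil -[LHS]/(evalp phi << mone >>) evalpU /word_eval fm1 big_nil.
Qed.

Lemma evalp_commr p q : evalp phi (commr p q) = commr (evalp phi p) (evalp phi q).
Proof.
apply: (etrans (evalpB _ _)).
exact: (congr2 (fun x y => x - y) (evalpM p q) (evalpM q p)).
Qed.

Lemma evalp_lcomm p s : evalp phi (lcomm p s) = lcomm (evalp phi p) [seq evalp phi q | q <- s].
Proof. by elim: s p => //= q s IH p; rewrite /lcomm /= -/(lcomm _ _) IH evalp_commr. Qed.

Lemma evalp_comp (sigma : var -> FA F) p :
  evalp phi (evalp sigma p) = evalp (fun v => evalp phi (sigma v)) p.
Proof.
rewrite [X in evalp phi X]/evalp.
apply: (etrans (evalp_sum _ _)); apply: eq_bigr => m _.
by rewrite evalpZ evalp_prod.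
Qed.

End Evaluation.

(** * Scalars, words and parity in the free algebra *)

Section FreeAlgebra.
Variable F : fieldType.
Implicit Types p q : FA F.

Lemma FA_scaleAr (c : F) p q : c *: (p * q) = p * (c *: q).
Proof.
apply/malgP => m; apply: (etrans (mcoeffZ c (p * q) m)).
apply: (etrans (congr1 ( *%R c) (mcoeffMl p q m))).
apply: (etrans _ (esym (mcoeffMlw m (fsubset_refl (msupp p)) (msuppZ_le c q)))).
rewrite mulr_sumr; apply: eq_bigr => m1 _; rewrite mulr_sumr; apply: eq_bigr => m2 _.
by rewrite mcoeffZ mulrnAr mulrCA.
Qed.

Lemma prod_letters (m : {fmonom var}) : \prod_(v <- (m : seq var)) << fmu v >> = << m >> :> FA F.
Proof.
case: m => s; elim: s => [|v s IH] /=.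
  by rewrite big_nil; congr << _ >>; rewrite -fmoneE.
rewrite big_cons IH [LHS]fgmulUU mulr1; congr << _ >>.
by apply/eqP; rewrite fmP fmM fmU.
Qed.

Lemma evalp_id p : evalp (fun v => << fmu v >>) p = p.
Proof.
rewrite [RHS]monalgE; apply: eq_bigr => m _; rewrite prod_letters.
apply/malgP => m'; apply: (etrans (mcoeffZ p@_m << m >> m')).
apply: (etrans (congr1 ( *%R p@_m) (mcoeffU m 1 m'))).
exact: (etrans (mulr_natr _ _) (esym (mcoeffU m p@_m m'))).
Qed.

Lemma even_yv i : is_even_poly F (yv F i).
Proof.
by move=> m; rewrite /yv msuppU oner_eq0 inE => /eqP->; rewrite /zdeg fmU.
Qed.

Lemma even_mul p q : is_even_poly F p -> is_even_poly F q -> is_even_poly F (p * q).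
Proof.
move=> pe qe m /msuppM_le[m1 [m2 [/pe m1e /qe m2e ->]]].
by rewrite /zdeg fmM count_cat oddD (negPf m1e) (negPf m2e).
Qed.

Lemma even_sub p q : is_even_poly F p -> is_even_poly F q -> is_even_poly F (p - q).
Proof.
by move=> pe qe m /(fsubsetP (msuppB_le p q)); rewrite inE => /orP[/pe|/qe].
Qed.

Lemma even_commr p q : is_even_poly F p -> is_even_poly F q -> is_even_poly F (commr p q).
Proof. by move=> pe qe; apply: even_sub; apply: even_mul. Qed.

Lemma even_wprod s : is_even_poly F (wprod (yv F) s).
Proof.
apply: (big_ind (is_even_poly F)) => [|p q|i _]; [|exact: even_mul|exact: even_yv].
by move=> m; rewrite /= msuppC oner_eq0 inE => /eqP->; rewrite /zdeg fm1.
Qed.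

Lemma even_lcomm p s : is_even_poly F p -> (forall q, q \in s -> is_even_poly F q) ->
  is_even_poly F (lcomm p s).
Proof.
elim: s p => //= q s IH p pe se; rewrite /lcomm /= -/(lcomm _ _).
apply: IH => [|r rs]; last by apply: se; rewrite inE rs orbT.
by apply: even_commr => //; apply: se; rewrite mem_head.
Qed.

End FreeAlgebra.

(** * Values of the T2-ideal under graded evaluations *)

Section GradedEvaluation.
Variables (F : fieldType) (n : nat).
Hypothesis n_gt0 : (0 < n)%N.
Implicit Types (p q : {poly F}) (phi : var -> 'M[F]_n.+1).

Let scaleAr (c : F) (x y : 'M[F]_n.+1) : c *: (x * y) = x * (c *: y) := scalerAr c x y.

Lemma eval_btoep phi f : graded_eval_Nk F n.+1 phi -> exists p u, eval_mx phi f = btoep n p u.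
Proof.
case=> phi_even phi_odd.
have letter v : exists p u, phi v = btoep n p u.
  by case: v => i; [exact/(NkP _ n_gt0) | exists 0, 0; rewrite phi_odd btoep0].
have word (m : seq var) : exists p u, \prod_(v <- m) phi v = btoep n p u.
  elim: m => [|v m [p [u IH]]]; first by exists 1, 0; rewrite big_nil btoep1.
  have [q [w vE]] := letter v; rewrite big_cons IH vE.
  by exists (q * p), (q`_0 *: u + w * p); rewrite btoepM.
rewrite /eval_mx; elim/big_ind: _ => [|_ _ [p [u ->]] [q [w ->]]|m _].
- by exists 0, 0; rewrite btoep0.
- by exists (p + q), (u + w); rewrite btoepD.
- by have [p [u ->]] := word m; exists (f@_m *: p), (f@_m *: u); rewrite btoepZ.
Qed.

(** A word of odd degree contains an odd variable, whose value is 0; so odd polynomials take the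
    value 0. *)
Lemma graded_eval_comp phi (sigma : var -> FA F) : graded_eval_Nk F n.+1 phi ->
  (forall i, is_odd_poly F (sigma (inr i))) ->
  graded_eval_Nk F n.+1 (fun v => eval_mx phi (sigma v)).
Proof.
move=> phiP sigma_odd; split=> i; first exact/(NkP _ n_gt0)/eval_btoep.
apply: big1_seq => m /andP[_ /sigma_odd].
suff : has (fun v : var => if v is inr _ then true else false) m -> \prod_(v <- m) phi v = 0.
  move=> zero; rewrite /zdeg => odd_z; rewrite zero ?scaler0 // has_count.
  by case: (count _ _) odd_z.
elim: (m : seq var) => //= [[j|j] s IH] /= zs; rewrite big_cons; first by rewrite IH ?mulr0.
by rewrite phiP.2 mul0r.
Qed.

(** Every bracket contributes a factor X, because [q] minus its constant term is divisible by X. The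
    first bracket is separate: there the block part of the left entry is not yet 0. *)
Lemma lcomm_btoep p u (s : seq 'M[F]_n.+1) : s != [::] ->
  (forall B, B \in s -> exists q v, B = btoep n q v) ->
  exists r, lcomm (btoep n p u) s = btoep n 0 ('X^(size s) * r).
Proof.
have Xdiff q : exists q', q - (q`_0)%:P = 'X * q'.
  exists (\poly_(i < size q) q`_i.+1); apply/polyP => i.
  rewrite coefB coefC coefXM; case: i => [|i] /=; first by rewrite subrr.
  rewrite subr0 coef_poly; case: ltnP => // qi; rewrite nth_default //.
  exact: leqW.
elim/last_ind: s => // s B IH _ sB; rewrite lcomm_rcons size_rcons.
have [|q [v ->]] := sB B; first by rewrite mem_rcons mem_head.
have [q' qq'] := Xdiff q.
case: s => [|C s] in IH sB *.
  have [p' pp'] := Xdiff p; exists (u * q' - v * p').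
  by rewrite /lcomm /= btoep_commr qq' pp'; congr btoep; rewrite expr1; ring.
have [|r ->] := IH isT; first by move=> D Ds; apply: sB; rewrite mem_rcons inE Ds orbT.
exists (r * q'); rewrite btoep_commr qq' coef0 subr0 mulr0 subr0.
by congr btoep; rewrite [in RHS]exprS; ring.
Qed.

(* For [d = n] the multiples of [X^d] give the zero matrix, for [d = n - 1] the
   scalar multiples of [e_{1,n+1}]. *)
Lemma T2_gen_eval d f : (0 < d)%N -> T2_gen F (thm_gens F d.+2) f ->
  forall phi, graded_eval_Nk F n.+1 phi -> exists r, eval_mx phi f = btoep n 0 ('X^d * r).
Proof.
move=> d0 fT; pose I (g : FA F) := forall phi, graded_eval_Nk F n.+1 phi ->
  exists r, eval_mx phi g = btoep n 0 ('X^d * r).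
apply: (fT I); last first.
  move=> g gens phi phiP.
  have yE i : evalp phi (yv F i) = phi (inl i) by apply: evalp_var.
  have phi_btoep i : exists p u, phi (inl i) = btoep n p u.
    by apply/(NkP _ n_gt0); apply: phiP.1.
  change (exists r, evalp phi g = btoep n 0 ('X^d * r)).
  case: gens => [|[]] ->.
  (* For k = d + 2 the long generator brackets y_1 with d further variables, whence the exponent
     d. *)
  - rewrite evalp_lcomm // yE -map_comp; have [p [u ->]] := phi_btoep 1.
    have := @lcomm_btoep p u [seq phi (inl i) | i <- iota 2 d].
    rewrite size_map size_iota => H.
    case: H => [|B /mapP[i _ ->]|r H]; [by case: (d) d0|exact: phi_btoep|].
    by exists r; rewrite -H; congr lcomm; apply: eq_map => i /=; rewrite yE.
  - have commE i j : evalp phi (commr (yv F i) (yv F j)) = commr (phi (inl i)) (phi (inl j)).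
      by rewrite (evalp_commr _ scaleAr) !yE.
    exists 0; rewrite [X in btoep _ _ X]mulr0.
    apply: (etrans (@evalpM _ _ phi scaleAr _ _)).
    apply: (etrans (congr2 *%R (commE 1 2) (commE 3 4))).
    have [p1 [u1 ->]] := phi_btoep 1; have [p2 [u2 ->]] := phi_btoep 2.
    have [p3 [u3 ->]] := phi_btoep 3; have [p4 [u4 ->]] := phi_btoep 4.
    by rewrite !btoep_commr btoepM coef0 scale0r !mulr0 addr0.
  - by exists 0; rewrite evalp_var phiP.2 mulr0 btoep0.
split=> [phi phiP|p q Ip Iq phi phiP|p q Ip phi phiP|p q Ip phi phiP|sigma _ odd p Ip phi phiP].
- by exists 0; rewrite mulr0 btoep0; apply: evalp0.
- have [[r pE] [s qE]] := (Ip _ phiP, Iq _ phiP); exists (r + s).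
  rewrite mulrDr -[0]addr0 -btoepD -pE -qE; exact: evalpD.
- have [r pE] := Ip _ phiP; have [b [u qE]] := eval_btoep q phiP.
  exists (b`_0 *: r); rewrite -[LHS]/(evalp phi (q * p)) evalpM //.
  rewrite [evalp phi p]pE [evalp phi q]qE btoepM !mulr0 addr0.
  by rewrite scalerAr.
- have [r pE] := Ip _ phiP; have [b [u qE]] := eval_btoep q phiP.
  exists (r * b); rewrite -[LHS]/(evalp phi (p * q)) evalpM //.
  by rewrite [evalp phi p]pE [evalp phi q]qE btoepM mul0r coef0 scale0r add0r mulrA.
- have [r pE] := Ip _ (graded_eval_comp phiP odd); exists r.
  by apply: etrans pE; apply: evalp_comp.
Qed.

End GradedEvaluation.

(** * Words with and without odd variables *)

Definition even_letters (m : {fmonom var}) : seq nat :=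
  pmap (fun v : var => if v is inl i then Some i else None) (m : seq var).

(** Words with no odd variable at all, not words of even degree: every other word vanishes under
    graded evaluation and lies in the T2-ideal. *)
Definition even_words (F : fieldType) (f : FA F) : seq {fmonom var} :=
  [seq m <- msupp f | zdeg m == 0].

Lemma prod_even_word (A : pzRingType) (phi : var -> A) (m : {fmonom var}) : zdeg m == 0 ->
  \prod_(v <- (m : seq var)) phi v = wprod (fun i => phi (inl i)) (even_letters m).
Proof.
rewrite /zdeg /even_letters /wprod; elim: (m : seq var) => [|[i|i] s IH] //= zs.
  by rewrite !big_nil.
by rewrite !big_cons IH.
Qed.

(** [P] stands for an absorbing property: membership in an ideal, or being 0. *)
Lemma prod_word_odd (A : pzRingType) (phi : var -> A) (P : A -> Prop) (m : {fmonom var}) :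
  (forall x y, P x -> P (x * y)) -> (forall x y, P x -> P (y * x)) ->
  (forall i, P (phi (inr i))) -> zdeg m != 0 -> P (\prod_(v <- (m : seq var)) phi v).
Proof.
move=> Pr Pl Pz; rewrite /zdeg; elim: (m : seq var) => [|[i|i] s IH] //= zs.
  by rewrite big_cons; apply/Pl/IH.
by rewrite big_cons; apply: Pr.
Qed.

Lemma evalp_even_odd (F : fieldType) (A : lalgType F) (phi : var -> A) f : evalp phi f =
  \sum_(m <- even_words f) f@_m *: wprod (fun i => phi (inl i)) (even_letters m) +
  \sum_(m <- msupp f | zdeg m != 0) f@_m *: \prod_(v <- (m : seq var)) phi v.
Proof.
rewrite /evalp (bigID (fun m => zdeg m == 0)) /= big_filter; congr (_ + _).
by apply: eq_bigr => m mz; rewrite prod_even_word.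
Qed.

(** * The membership criterion for T2-ideals containing the generators *)

Section T2Ideal.
Variables (F : fieldType) (d : nat) (I : FA F -> Prop).
Hypotheses (Fchar0 : [pchar F] =i pred0)
  (I_T2 : is_T2_ideal F I) (I_gens : forall g, thm_gens F d.+2 g -> I g).

Let I0 : I 0. Proof. by case: I_T2. Qed.
Let ID p q : I p -> I q -> I (p + q). Proof. by case: I_T2 => _ H _ _ _; apply: H. Qed.
Let IMl p q : I p -> I (q * p). Proof. by case: I_T2 => _ _ H _ _; apply: H. Qed.
Let IMr p q : I p -> I (p * q). Proof. by case: I_T2 => _ _ _ H _; apply: H. Qed.
Let IZ c p : I p -> I (c *: p).
Proof. by move=> Ip; rewrite -[p]mul1r scalerAl; apply: IMl. Qed.
Let IB p q : I p -> I q -> I (p - q).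
Proof. by move=> Ip Iq; rewrite -scaleN1r; apply: ID => //; apply: IZ. Qed.

Lemma T2_ideal_subst (sigma : nat -> FA F) p : (forall i, is_even_poly F (sigma i)) -> I p ->
  I (evalp (fun v => if v is inl i then sigma i else 0) p).
Proof.
move=> even_sigma Ip; case: I_T2 => _ _ _ _; apply=> // i m.
by rewrite msupp0.
Qed.

Lemma T2_ideal_odd i : I (zv F i).
Proof.
have := I_gens (or_intror (or_intror erefl)).
case: I_T2 => _ _ _ _ /(_ (fun v => if v is inr _ then zv F i else 0)) H /H.
rewrite (evalp_var _ (inr 1)); apply => j m; first by rewrite msupp0.
by rewrite /zv msuppU oner_eq0 inE => /eqP->; rewrite /zdeg fmU.
Qed.

Lemma T2_ideal_commr2 (a b c e : FA F) :
  is_even_poly F a -> is_even_poly F b -> is_even_poly F c -> is_even_poly F e ->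
  I (commr a b * commr c e).
Proof.
move=> ae be ce ee; have := I_gens (or_intror (or_introl erefl)).
(* The generator involves y_1 to y_4; index 0 is padding. *)
pose sigma i := nth 0 [:: 0; a; b; c; e] i.
have even0 : is_even_poly F 0 by move=> m; rewrite msupp0.
have sigma_even i : is_even_poly F (sigma i) by case: i => [|[|[|[|[|[|i]]]]]].
move/(T2_ideal_subst sigma_even); congr I.
set phi := fun v => _.
have commE i j : evalp phi (commr (yv F i) (yv F j)) = commr (sigma i) (sigma j).
  by rewrite (evalp_commr phi (@FA_scaleAr F) (yv F i) (yv F j)) !evalp_var.
apply: (etrans (evalpM phi (@FA_scaleAr F) _ _)).
exact: (congr2 *%R (commE 1 2) (commE 3 4)).
Qed.

(** The outermost bracket of [lcomm] is itself a commutator, and the Leibniz rule absorbs the word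
    [v] into the first one; both resulting terms contain a product of two adjacent commutators. *)
Lemma T2_ideal_commr_mul i s v x t : t != [::] ->
  I (commr (yv F i) (wprod (yv F) s) * wprod (yv F) v * lcomm (yv F x) [seq yv F j | j <- t]).
Proof.
case/lastP: t => // t j _; rewrite map_rcons lcomm_rcons.
set a := yv F i; set b := wprod _ s; set c := wprod _ v; set l := lcomm _ _.
have le : is_even_poly F l.
  by apply: even_lcomm => [|_ /mapP[y _ ->]]; apply: even_yv.
have [ae be ce je] : [/\ is_even_poly F a, is_even_poly F b, is_even_poly F c
    & is_even_poly F (yv F j)].
  by split; [exact: even_yv|exact: even_wprod|exact: even_wprod|exact: even_yv].
rewrite (commr_mul_sub a b c) mulrBl -mulrA.
apply: IB; last apply: IMl; apply: T2_ideal_commr2 => //.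
exact: even_mul.
Qed.

Lemma T2_ideal_lcomm x t : (d <= size t)%N -> I (lcomm (yv F x) [seq yv F j | j <- t]).
Proof.
move=> dt; have Il : I (lcomm (yv F x) [seq yv F j | j <- take d t]).
  have := I_gens (or_introl erefl).
  (* The generator starts at y_1, so y_1 goes to [x] and y_(i+2) to entry i of [t]. *)
  pose sigma i := yv F (if i is i'.+2 then nth 0%N t i' else x).
  have sigma_even i : is_even_poly F (sigma i) by apply: even_yv.
  move/(T2_ideal_subst sigma_even); congr I.
  rewrite (evalp_lcomm _ (@FA_scaleAr F)) evalp_var; congr lcomm.
  apply: (@eq_from_nth _ 0) => [|i]; rewrite !size_map size_iota ?size_takel // => id.
  rewrite -map_comp !(nth_map 0%N) ?size_iota ?size_takel //= nth_iota // nth_take //.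
  by rewrite evalp_var.
have step p s : I p -> I (lcomm p [seq yv F j | j <- s]).
  elim: s p => //= j s IH p Ip; apply: IH.
  by apply: IB; [apply: IMr | apply: IMl].
by rewrite -(cat_take_drop d t) map_cat /lcomm foldl_cat; apply: step.
Qed.

Lemma mem_T2_ideal f :
  (forall a : nat -> F,
     \sum_(m <- even_words f) f@_m * \prod_(i <- even_letters m) a i = 0) ->
  (forall (a b u : nat -> F) l, (l.+1 < d)%N ->
     \sum_(m <- even_words f) f@_m * (corner_eval a b u (even_letters m))`_l.+1 = 0) ->
  I f.
Proof.
move=> H0 H1; pose phi v : FA F := << fmu v >>.
(* [f] is its own value at the variables. The words without odd variables fall under the criterion;
   the others are in [I] because all odd variables are. *)
apply: (eq_ind_r I _ (etrans (esym (evalp_id f)) (evalp_even_odd phi f))).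
apply: ID.
  exact: (@mem_ideal_of_evaluations F _ (yv F) I d Fchar0 I0 ID IZ IMl
    T2_ideal_commr_mul T2_ideal_lcomm _ (even_words f) (fun m => f@_m) even_letters H0 H1).
rewrite big_mkcond; apply: big_ind => // m _; case: ifP => // mz.
exact: (IZ _ (@prod_word_odd _ phi I m IMr IMl T2_ideal_odd mz)).
Qed.

End T2Ideal.

(** * Evaluation at generic matrices *)

Section GenericMatrices.
Variables (F : fieldType) (n : nat) (a b u : nat -> F).

Definition generic_mx (v : var) : 'M[F]_n.+1 :=
  if v is inl i then btoep n ((a i)%:P + b i *: 'X) (u i)%:P else 0.

Lemma generic_mx_graded : (0 < n)%N -> graded_eval_Nk F n.+1 generic_mx.
Proof. by move=> n0; split=> // i; apply/(NkP _ n0); do 2!eexists. Qed.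

Lemma wprod_generic_mx w : wprod (fun i => generic_mx (inl i)) w =
  btoep n (linear_eval a b w) (corner_eval a b u w).
Proof.
elim: w => [|x w IH]; first by rewrite /wprod /linear_eval !big_nil btoep1.
rewrite /wprod big_cons -/(wprod _ w) IH btoepM /= /linear_eval big_cons.
by rewrite coefD coefC coefZ coefX mulr0 addr0 mul_polyC.
Qed.

Lemma eval_generic_mx f : eval_mx generic_mx f =
  btoep n (\sum_(m <- even_words f) f@_m *: linear_eval a b (even_letters m))
          (\sum_(m <- even_words f) f@_m *: corner_eval a b u (even_letters m)).
Proof.
rewrite -btoep_sum /eval_mx (bigID (fun m => zdeg m == 0)) /= -big_filter.
rewrite -/(even_words f) [X in _ + X]big1 ?addr0 => [|m mz].
  apply: eq_big_seq => m; rewrite mem_filter => /andP[mz _].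
  by rewrite prod_even_word // wprod_generic_mx btoepZ.
rewrite (@prod_word_odd _ generic_mx (fun B => B = 0)) ?scaler0 //.
  by move=> x y ->; rewrite mul0r.
by move=> x y ->; rewrite mulr0.
Qed.

End GenericMatrices.

(** * Identities and central polynomials against the T2-ideal *)

Lemma T2_gen_of_coefs (F : fieldType) (n : nat) (f : FA F) :
  [pchar F] =i pred0 ->
  (forall a : nat -> F,
     \sum_(m <- even_words f) f@_m * \prod_(i <- even_letters m) a i = 0) ->
  (forall (a b u : nat -> F) l, (l < n)%N ->
     \sum_(m <- even_words f) f@_m * (corner_eval a b u (even_letters m))`_l = 0) ->
  T2_gen F (thm_gens F n.+2) f.
Proof.
move=> Fchar0 H0 H1 I I_T2 I_gens.
by apply: (mem_T2_ideal Fchar0 I_T2 I_gens H0) => a b u l; apply: H1.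
Qed.

Lemma Id_gr_T2_gen (F : fieldType) (n : nat) (f : FA F) :
  [pchar F] =i pred0 -> (0 < n)%N ->
  Id_gr_Nk F n.+1 f -> T2_gen F (thm_gens F n.+2) f.
Proof.
move=> Fchar0 n0 f_id.
have eval0 a b u := f_id _ (generic_mx_graded a b u n0).
apply: T2_gen_of_coefs => // [a|a b u l ln].
  (* At scalar matrices the corner entry is the commutative image of [f]. *)
  have := eval0 a (fun=> 0) (fun=> 0); rewrite eval_generic_mx -btoep0 => /btoep_inj[+ _ _].
  rewrite coef0 coef_sum => sum0; apply: etrans sum0; apply: eq_bigr => m _.
  rewrite coefZ /linear_eval coef0_prod; congr (_ * _); apply: eq_bigr => i _.
  by rewrite scale0r addr0 coefC.
have := eval0 a b u; rewrite eval_generic_mx -btoep0 => /btoep_inj[_ _ /(_ l ln)].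
rewrite coef0 coef_sum => sum0; apply: etrans sum0; apply: eq_bigr => m _.
by rewrite coefZ.
Qed.

(** Euler's identity: the product of the a_i (1 + X) is (1 + X)^(size w) times the product of the
    a_i. *)
Lemma coef1_linear_eval (F : fieldType) (a : nat -> F) w :
  (linear_eval a a w)`_1 = (size w)%:R * \prod_(i <- w) a i.
Proof.
have coef0E s : (linear_eval a a s)`_0 = \prod_(i <- s) a i.
  rewrite /linear_eval coef0_prod; apply: eq_bigr => i _.
  by rewrite coefD coefC coefZ coefX mulr0 addr0.
elim: w => [|x w IH]; first by rewrite /linear_eval !big_nil coef1 mul0r.
rewrite {1}/linear_eval big_cons -/(linear_eval a a w) mulrDl coefD.
rewrite coefCM -scalerAl coefZ coefXM /= IH coef0E big_cons -[(size w).+1]addn1 natrD.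
by rewrite mulrDl mul1r [in RHS]mulrCA.
Qed.

Lemma C_gr_T2_gen (F : fieldType) (n : nat) (f : FA F) :
  [pchar F] =i pred0 -> (0 < n)%N ->
  C_gr_Nk F n.+2 f -> T2_gen F (thm_gens F n.+2) f.
Proof.
move=> Fchar0 n0 [f1 f_central].
have central a b u q v :
    commr (eval_mx (generic_mx n.+1 a b u) f) (btoep n.+1 q v) = 0.
  have [_ comm] := f_central _ (@generic_mx_graded _ n.+1 a b u isT).
  by rewrite /commr comm ?subrr //; apply/NkP => //; do 2!eexists.
apply: T2_gen_of_coefs => // [a|a b u l ln]; last first.
  (* The commutator with E - e_12 multiplies the top row by X, so its coefficient l + 1 is
     coefficient l of the row. *)
  have := central a b u 'X 0; rewrite eval_generic_mx btoep_commr -btoep0.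
  case/btoep_inj => _ _ /(_ l.+1); rewrite ltnS mul0r subr0 coefX subr0 coefMX coef0 /=.
  rewrite coef_sum => /(_ ln) sum0; apply: etrans sum0; apply: eq_bigr => m _.
  by rewrite coefZ.
have sum1 (theta : nat -> F) :
    \sum_(m <- even_words f) f@_m * (size (even_letters m))%:R
      * \prod_(i <- even_letters m) theta i = 0.
  (* The commutator with e_12 exposes the block polynomial without its constant term; its
     coefficient of X can be read off since [n > 0]. *)
  have := central theta theta (fun=> 0) 0 1.
  rewrite eval_generic_mx btoep_commr -btoep0.
  case/btoep_inj => _ _ /(_ 1); rewrite ltnS !coef0 subrr mulr0 sub0r mul1r coefN.
  move=> /(_ n0) /eqP; rewrite oppr_eq0 coefB coefC subr0 coef_sum => /eqP sum0.
  apply: etrans sum0; apply: eq_bigr => m _.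
  by rewrite coefZ coef1_linear_eval mulrA.
(* Division by the degree. For the empty word the inverse of 0 is 0 by convention, which is harmless
   because the constant term of [f] is 0. *)
pose val (m : {fmonom var}) : F^o :=
  (size (even_letters m))%:R^-1 * \prod_(i <- even_letters m) a i.
have := @sum_scale_of_monomials F F^o _ _ (even_words f)
  (fun m => f@_m * (size (even_letters m))%:R) even_letters val Fchar0 _ sum1.
move=> sum0; apply: etrans (sum0 _); last first.
  by move=> m m' mm'; rewrite /val (perm_size mm') (perm_big _ mm').
apply: eq_big_seq => m; rewrite mem_filter => /andP[mz _].
rewrite /val /= -[RHS]/(_ * (_ * _)) mulrA -[X in _ = X * _]mulrA.
have [w0|w0] := eqVneq (size (even_letters m)) 0%N; last first.
  by rewrite divff ?mulr1 //; move/pcharf0P: Fchar0 => ->.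
suff -> : m = mone by rewrite f1 !mul0r.
apply/eqP; rewrite fmP fm1; move: mz w0; rewrite /zdeg /even_letters.
by case: (m : seq var) => [|[i|i] s].
Qed.

Lemma T2_gen_Id_gr (F : fieldType) (n : nat) (f : FA F) : (0 < n)%N ->
  T2_gen F (thm_gens F n.+2) f -> Id_gr_Nk F n.+1 f.
Proof.
move=> n0 fT phi phiP; have [r ->] := T2_gen_eval n0 n0 fT phiP.
by rewrite -btoep0; apply: btoep_eq => // j jn; rewrite coefXnM jn coef0.
Qed.

(** Evaluation at 0 reads off the constant term, which has to vanish for a central polynomial. *)
Lemma eval_zero (F : fieldType) (n : nat) (f : FA F) :
  eval_mx (fun=> 0 : 'M[F]_n.+1) f = f@_mone *: 1.
Proof.
have wordE (m : {fmonom var}) : \prod_(v <- (m : seq var)) 0 = (m == mone)%:R :> 'M[F]_n.+1.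
  rewrite fmP fm1; case: (m : seq var) => [|v s]; first by rewrite big_nil.
  by rewrite big_cons mul0r.
transitivity (\sum_(m <- msupp f | m == mone) f@_m *: (1 : 'M[F]_n.+1)).
  rewrite [RHS]big_mkcond; apply: eq_bigr => m _; rewrite wordE.
  by case: eqP => _; rewrite ?scaler0.
case: (msuppP f mone) => [f1|f1].
  rewrite big_mkcond (bigD1_seq mone f1 (fset_uniq _)) /= eqxx big1 ?addr0 //.
  by move=> m /negPf->.
by rewrite scale0r big1_seq // => m /andP[/eqP ->]; rewrite (negPf f1).
Qed.

Lemma T2_gen_C_gr (F : fieldType) (n : nat) (f : FA F) : (0 < n)%N ->
  T2_gen F (thm_gens F n.+2) f -> C_gr_Nk F n.+2 f.
Proof.
move=> n0 fT; have eval_f := T2_gen_eval (ltn0Sn n) n0 fT.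
split=> [|phi phiP].
  have [|r] := eval_f (fun=> 0).
    by split=> // i; apply/NkP => //; exists 0, 0; rewrite btoep0.
  rewrite eval_zero -btoep1 btoepZ => /btoep_inj[+ _ _].
  by rewrite coefZ coef1 mulr1 coef0.
have [r ->] := eval_f _ phiP; split; first by apply/NkP => //; do 2!eexists.
move=> _ /NkP[] // q [v ->]; rewrite !btoepM coef0 scale0r add0r !mulr0 mul0r addr0.
apply: btoep_eq => // j; rewrite ltnS => jn.
(* Multiplying X^n r by [q] on the right or by its constant term on the left gives the same row
   modulo X^(n+1): only coefficient n remains. *)
rewrite coefZ -mulrA !coefXnM; case: ltnP => [_|nj]; first by rewrite mulr0.
have -> : j = n by apply/eqP; rewrite eqn_leq jn nj.
by rewrite subnn coef0M mulrC.
Qed.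

Theorem theorem3p3 (F : fieldType) (Fchar0 : [pchar F] =i pred0) (k : nat) (hk : (3 <= k)%N) :
  (forall f : FA F, C_gr_Nk F k f <-> Id_gr_Nk F k.-1 f) /\
  (forall f : FA F, Id_gr_Nk F k.-1 f <-> T2_gen F (thm_gens F k) f).
Proof.
case: k hk => [|[|n]] // n0.
have Id_T2 f : Id_gr_Nk F n.+1 f <-> T2_gen F (thm_gens F n.+2) f.
  by split; [apply: Id_gr_T2_gen | apply: T2_gen_Id_gr].
split=> // f; rewrite Id_T2; split; [exact: C_gr_T2_gen | exact: T2_gen_C_gr].
Qed.
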